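(* Let $G$ be a finite nonabelian group with $Z^\otimes(G)=1$ and let $p$ be the smallest prime dividing $|G|$. Then $d^\otimes(G)\le\frac{1}{p}$.
   Context: All groups are finite. For elements of a group write ${}^{x}y=xyx^{-1}$. The nonabelian tensor square $G\otimes G$ of a group $G$ is the group generated by the symbols $g\otimes h$ ($g,h\in G$) with defining relations $xy\otimes h=({}^{x}y\otimes{}^{x}h)(x\otimes h)$ and $x\otimes hk=(x\otimes h)({}^{h}x\otimes{}^{h}k)$ for all $x,y,h,k\in G$. The tensor center is $Z^\otimes(G)=\{g\in G\mid g\otimes y=1_{G\otimes G}\ \forall y\in G\}$, a subgroup of the center $Z(G)$. The tensor degree is $d^\otimes(G)=|\{(x,y)\in G\times G\mid x\otimes y=1_{G\otimes G}\}|/|G|^2$. *)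

(* Defs.v *)
From HB Require Import structures.
From mathcomp Require Import all_boot all_algebra all_fingroup.
From mathcomp Require Import generic_quotient.
From mathcomp Require Import boolp.

Set Implicit Arguments.
Unset Strict Implicit.
Unset Printing Implicit Defensive.

Local Open Scope group_scope.
Local Open Scope quotient_scope.

(* Groups given by generators and relations. The letter (x, false) stands for
   the generator x and (x, true) for its formal inverse. *)
Section Presentation.

Variable X : choiceType.

Definition word : Type := seq (X * bool).

Definition gen (x : X) : word := [:: (x, false)].

Definition winv (w : word) : word := rev [seq (a.1, ~~ a.2) | a <- w].

Variable R : word -> word -> Prop.

Inductive pres_eq : word -> word -> Prop :=
| pres_rel u v : R u v -> pres_eq u v
| pres_cancel x b : pres_eq [:: (x, b); (x, ~~ b)] [::]
| pres_refl u : pres_eq u u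
| pres_sym u v : pres_eq u v -> pres_eq v u
| pres_trans u v w : pres_eq u v -> pres_eq v w -> pres_eq u w
| pres_cat u u' v v' :
    pres_eq u u' -> pres_eq v v' -> pres_eq (u ++ v) (u' ++ v').

Lemma winvK : involutive winv.
Proof.
move=> w; rewrite /winv map_rev revK -map_comp -[RHS]map_id.
by apply: eq_map => -[x b] /=; rewrite negbK.
Qed.

Lemma winv_cat u v : winv (u ++ v) = winv v ++ winv u.
Proof. by rewrite /winv map_cat rev_cat. Qed.

Lemma pres_mulV w : pres_eq (w ++ winv w) [::].
Proof.
elim: w => [|[x b] w IHw]; first exact: pres_refl.
rewrite -cat1s winv_cat -catA [w ++ _]catA.
apply: pres_trans (pres_cancel x b); apply: pres_cat (pres_refl _) _.
exact: (pres_cat IHw (pres_refl _)).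
Qed.

Lemma pres_Vmul w : pres_eq (winv w ++ w) [::].
Proof. by rewrite -{2}[w]winvK; apply: pres_mulV. Qed.

Lemma pres_inv u v : pres_eq u v -> pres_eq (winv u) (winv v).
Proof.
move=> uv; apply: (@pres_trans _ (winv u ++ v ++ winv v)).
  rewrite -{1}[winv u]cats0; apply: pres_cat (pres_refl _) _.
  exact/pres_sym/pres_mulV.
rewrite catA -{2}[winv v]cat0s; apply: pres_cat (pres_refl _).
apply: pres_trans (pres_Vmul u).
exact: pres_cat (pres_refl _) (pres_sym uv).
Qed.

Definition pres_eqb : rel word := fun u v => `[< pres_eq u v >].

Lemma pres_eqb_refl : reflexive pres_eqb.
Proof. by move=> u; apply/asboolP/pres_refl. Qed.

Lemma pres_eqb_sym : symmetric pres_eqb.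
Proof. by move=> u v; apply/asboolP/asboolP; apply: pres_sym. Qed.

Lemma pres_eqb_trans : transitive pres_eqb.
Proof.
by move=> v u w /asboolP uv /asboolP vw; apply/asboolP/(pres_trans uv vw).
Qed.

Canonical pres_equiv :=
  EquivRel pres_eqb pres_eqb_refl pres_eqb_sym pres_eqb_trans.

Definition presented : Type := {eq_quot pres_equiv}.

HB.instance Definition _ := Choice.on presented.
HB.instance Definition _ := EqQuotient.on presented.

Definition pres_class (w : word) : presented := \pi_presented w.

Definition pres_mul (a b : presented) : presented :=
  pres_class (repr a ++ repr b).

Definition pres_one : presented := pres_class [::].

Definition pres_invg (a : presented) : presented :=
  pres_class (winv (repr a)).

Lemma pres_classP u v : pres_class u = pres_class v <-> pres_eq u v.
Proof.
split=> [/eqP|uv]; first by rewrite piE => /asboolP.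
by apply/eqP; rewrite piE; apply/asboolP.
Qed.

Lemma pres_reprK a : pres_class (repr a) = a.
Proof. exact: reprK. Qed.

Lemma pres_mulE u v : pres_mul (pres_class u) (pres_class v) = pres_class (u ++ v).
Proof.
by apply/pres_classP/pres_cat; apply/pres_classP; rewrite pres_reprK.
Qed.

Lemma pres_invgE u : pres_invg (pres_class u) = pres_class (winv u).
Proof. by apply/pres_classP/pres_inv/pres_classP; rewrite pres_reprK. Qed.

Lemma pres_mulgA : associative pres_mul.
Proof.
move=> a b c; rewrite -(pres_reprK a) -(pres_reprK b) -(pres_reprK c).
by rewrite !pres_mulE catA.
Qed.

Lemma pres_mul1g : left_id pres_one pres_mul.
Proof. by move=> a; rewrite -(pres_reprK a) pres_mulE. Qed.

Lemma pres_mulg1 : right_id pres_one pres_mul.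
Proof. by move=> a; rewrite -(pres_reprK a) pres_mulE cats0. Qed.

Lemma pres_mulVg : left_inverse pres_one pres_invg pres_mul.
Proof.
move=> a; rewrite -(pres_reprK a) pres_invgE pres_mulE.
exact/pres_classP/pres_Vmul.
Qed.

Lemma pres_mulgV : right_inverse pres_one pres_invg pres_mul.
Proof.
move=> a; rewrite -(pres_reprK a) pres_invgE pres_mulE.
exact/pres_classP/pres_mulV.
Qed.

HB.instance Definition _ := isGroup.Build presented
  pres_mulgA pres_mul1g pres_mulg1 pres_mulVg pres_mulgV.

End Presentation.

Section TensorSquare.

Variable G : finGroupType.

(* The left conjugate of the text; MathComp's y ^ x is x^-1 * y * x. *)
Definition lconj (x y : G) : G := x * y * x^-1.

Inductive tensor_rel : word (G * G)%type -> word (G * G)%type -> Prop :=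
| tensor_relMl x y h :
    tensor_rel (gen (x * y, h)) (gen (lconj x y, lconj x h) ++ gen (x, h))
| tensor_relMr x h k :
    tensor_rel (gen (x, h * k)) (gen (x, h) ++ gen (lconj h x, lconj h k)).

Definition tensor_square : groupType := presented tensor_rel.

Definition tensor (x y : G) : tensor_square :=
  pres_class tensor_rel (gen (x, y)).

Definition tensor_center : {set G} := [set g | [forall y, tensor g y == 1]].

Definition tensor_degree : rat :=
  (#|[set u : G * G | tensor u.1 u.2 == 1%g]|%:R / (#|G| ^ 2)%:R)%R.

End TensorSquare.

(* Main.v *)
(* Write C(x) for the subgroup of all y with x (x) y = 1; this relation is
   symmetric, so a trivial tensor center makes C(x) proper, of index at least
   p, for x <> 1. If C(x) has index exactly p it is normal, hence contains the
   derived subgroup. Fixing k <> 1 in the derived subgroup, every such x lies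
   in the proper subgroup H = C(k), so that C(x) has index at least p + 1 for
   x outside H. As |H| <= n / p and n = |G| >= p (p + 1), the sum of the |C(x)|
   is at most n + (|H| - 1) n / p + (n - |H|) n / (p + 1) <= n ^ 2 / p. *)

Require Import Defs.
From mathcomp Require Import all_boot all_order all_algebra all_fingroup.
From mathcomp Require Import all_solvable.

Set Implicit Arguments.
Unset Strict Implicit.
Unset Printing Implicit Defensive.

Import Order.TTheory GRing.Theory Num.Theory.
Local Open Scope group_scope.

Section WordEvaluation.

Variables (X : choiceType) (T : groupType) (f : X -> T).

Definition word_eval (w : word X) : T :=
  foldr (fun a t => (if a.2 then (f a.1)^-1 else f a.1) * t) 1 w.

Lemma word_eval_gen x : word_eval (gen x) = f x.
Proof. by rewrite /= mulg1. Qed.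

Lemma word_eval_cat u v : word_eval (u ++ v) = word_eval u * word_eval v.
Proof. by elim: u => [|a u IHu] /=; rewrite ?mul1g // IHu mulgA. Qed.

(** The universal property of a presentation: a map on generators that respects the relations
    extends to the presented group. *)
Lemma word_eval_pres_eq (R : word X -> word X -> Prop) :
    (forall u v, R u v -> word_eval u = word_eval v) ->
  forall u v, pres_eq R u v -> word_eval u = word_eval v.
Proof.
move=> fR u v; elim=> {u v} //.
- by move=> x [] /=; rewrite mulg1 ?mulgV ?mulVg.
- by move=> u v w _ -> _ ->.
- by move=> u u' v v' _ uu' _ vv'; rewrite !word_eval_cat uu' vv'.
Qed.

End WordEvaluation.

(** For [g] outside [H], the product set of [H] and [H :^ g] misses [g], so it has fewer than [#|G|]
    elements. Hence [H :&: H :^ g] has index in [H] below the least prime divisor of [#|G|]; this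
    index divides [#|G|], so it is 1. *)
Lemma pdiv_index_normal (gT : finGroupType) (G H : {group gT}) :
  H \subset G -> #|G : H| = pdiv #|G| -> H <| G.
Proof.
move=> sHG iH; rewrite /normal sHG; apply/subsetP=> g Gg.
have [Hg | notHg] := boolP (g \in H).
  by rewrite (subsetP (normG H)).
have sHgG : H :^ g \subset G by rewrite -(conjGid Gg) conjSg.
have ltHHg : #|H * H :^ g| < #|G|.
  apply: proper_card; rewrite properE mul_subG //=.
  apply/subsetPn; exists g => //.
  (* If [g = h * k] with [k] in [H :^ g], then [g * k * g^-1 = g * h^-1] lies in [H], and so does
     [g]. *)
  apply: contra notHg => /mulsgP[h k Hh].
  rewrite mem_conjg => Hk /(congr1 (fun x => h^-1 * x)).
  rewrite mulKg => Dk; move: Hk; rewrite -Dk conjgE invgK !mulgA mulgK.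
  by rewrite groupMr ?groupV.
have ltHK : #|H : H :^ g| < pdiv #|G|.
  rewrite -iH -(ltn_pmul2l (cardG_gt0 H)) Lagrange //.
  apply: leq_ltn_trans ltHHg; rewrite -(leq_pmul2r (cardG_gt0 (H :&: H :^ g))).
  by rewrite -mul_cardG cardJg -mulnA [(#|H : _| * _)%N]mulnC LagrangeI.
have dvHK : #|H : H :^ g| %| #|G|.
  by rewrite -indexgI (dvdn_trans (dvdn_indexg _ _)) ?cardSg.
have iHK1 : #|H : H :^ g| = 1%N.
  apply/eqP; rewrite eqn_leq indexg_gt0 andbT leqNgt.
  by apply: contraL ltHK => /pdiv_min_dvd/(_ dvHK); rewrite -leqNgt.
have sHHg : H \subset H :^ g by rewrite -indexg_eq1 iHK1.
by rewrite inE -(eqP (_ : H :==: H :^ g)) // -(subset_leqif_cards sHHg).2 cardJg.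
Qed.

Section TensorCentralizer.

Variable G : finGroupType.
Implicit Types x y h : G.

Lemma tensor_mull x y h :
  tensor (x * y) h = tensor (lconj x y) (lconj x h) * tensor x h.
Proof.
by rewrite [RHS]pres_mulE; apply/pres_classP/pres_rel/tensor_relMl.
Qed.

Lemma tensor_mulr x y h :
  tensor x (y * h) = tensor x y * tensor (lconj y x) (lconj y h).
Proof.
by rewrite [RHS]pres_mulE; apply/pres_classP/pres_rel/tensor_relMr.
Qed.

Lemma tensor1P x y :
  tensor x y = 1 <-> pres_eq (@tensor_rel G) (gen (x, y)) [::].
Proof. exact: pres_classP. Qed.

Lemma tensor_eval (T : groupType) (f : G * G -> T) :
    (forall x y h, f (x * y, h) = f (lconj x y, lconj x h) * f (x, h)) ->
    (forall x y h, f (x, y * h) = f (x, y) * f (lconj y x, lconj y h)) ->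
  forall x y, tensor x y = 1 -> f (x, y) = 1.
Proof.
move=> fl fr x y /tensor1P exy; rewrite -(word_eval_gen f).
apply: (word_eval_pres_eq _ exy) => _ _ [a b c|a b c];
  by rewrite word_eval_cat !word_eval_gen.
Qed.

Lemma lconjM x y h : lconj x (y * h) = lconj x y * lconj x h.
Proof. by rewrite /lconj !mulgA mulgKV. Qed.

Lemma lconjJ x y h : lconj x (lconj y h) = lconj (lconj x y) (lconj x h).
Proof. by rewrite /lconj !invMg invgK !mulgA !mulgKV. Qed.

(** Conjugating both entries by [h] preserves each family of defining relations, so it induces an
    endomorphism of the tensor square. *)
Lemma tensor1_lconj h x y :
  tensor x y = 1 -> tensor (lconj h x) (lconj h y) = 1.
Proof.
pose f (u : G * G) := tensor (lconj h u.1) (lconj h u.2).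
move=> exy; apply: (tensor_eval (f := f)) exy => a b c; rewrite /f /= lconjM.
  by rewrite tensor_mull !(lconjJ h).
by rewrite tensor_mulr !(lconjJ h).
Qed.

(* The map sending x (x) y to (y (x) x)^-1 is an endomorphism of the tensor
   square, since it exchanges its two families of relations. *)
Lemma tensor1C x y : tensor x y = 1 -> tensor y x = 1.
Proof.
pose f (u : G * G) := (tensor u.2 u.1)^-1.
move=> exy; apply: invg_inj; rewrite invg1.
apply: (tensor_eval (f := f)) exy => a b c; rewrite /f /=.
  by rewrite tensor_mulr invgM.
by rewrite tensor_mull invgM.
Qed.

Definition tensor_cent x : {set G} := [set y | tensor x y == 1].

Lemma tensor_centC x y : (y \in tensor_cent x) = (x \in tensor_cent y).
Proof. by rewrite !inE; apply/eqP/eqP; apply: tensor1C. Qed.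

Lemma tensor_cent_group_set x : group_set (tensor_cent x).
Proof.
apply/group_setP; split=> [|y h]; rewrite !inE.
  (* Expanding [tensor x (1 * 1)] shows that [tensor x 1] is idempotent, hence trivial. *)
  have := tensor_mulr x 1 1; rewrite /lconj !mulg1 !mul1g invg1 !mulg1.
  by move/eqP; rewrite -[X in X == _]mulg1 (inj_eq (mulgI _)) eq_sym.
move=> /eqP exy /eqP exh.
by rewrite tensor_mulr exy mul1g (tensor1_lconj y exh).
Qed.

Canonical tensor_cent_group x := Group (tensor_cent_group_set x).

Lemma tensor_cent1 : tensor_cent 1 = [set: G].
Proof.
by apply/setP=> y; rewrite tensor_centC in_setT (group1 (tensor_cent_group y)).
Qed.

Lemma card_tensor1 :
  #|[set u : G * G | tensor u.1 u.2 == 1]| = (\sum_x #|tensor_cent x|)%N.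
Proof.
rewrite -sum1_card (eq_bigl (fun u => u.2 \in tensor_cent u.1)); last first.
  by move=> u; rewrite !inE.
rewrite -(pair_big_dep xpredT (fun x y => y \in tensor_cent x)
                       (fun _ _ => 1%N)).
by apply: eq_bigr => x _; rewrite sum1_card.
Qed.

Lemma tensor_cent_eqT x :
  (tensor_cent x == [set: G]) = (x \in tensor_center G).
Proof.
rewrite inE; apply/eqP/forallP => [/setP xT y | xT].
  by have := xT y; rewrite !inE.
by apply/setP=> y; rewrite !inE xT.
Qed.

End TensorCentralizer.

(** Write [#|G| = m * p]. Groups of order [p] or [p ^ 2] are abelian, so [m] is neither 1 nor [p];
    by minimality of [p], [m] exceeds [p]. *)
Lemma nonabelian_card_ge (gT : finGroupType) (G : {group gT}) (p := pdiv #|G|) :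
  ~~ abelian G -> prime p /\ p * p.+1 <= #|G|.
Proof.
move=> nabG; have G1 : 1 < #|G|.
  by rewrite cardG_gt1; apply: contraNneq nabG => ->; apply: abelian1.
have p_pr : prime p by apply: pdiv_prime.
split=> //; have [m oG] := dvdnP (pdiv_dvd #|G|).
rewrite -/p in oG; rewrite oG mulnC leq_pmul2r ?prime_gt0 //.
have m1 : 1 < m.
  case: m oG => [|[|//]] oG; first by rewrite oG in G1.
  case/negP: nabG; apply: cyclic_abelian; apply: prime_cyclic.
  by rewrite oG mul1n.
have : p <= m by apply: pdiv_min_dvd; rewrite // oG dvdn_mulr.
rewrite leq_eqVlt => /predU1P[pm | //].
by case/negP: nabG; apply: (card_p2group_abelian p_pr); rewrite oG -pm.
Qed.

Theorem theorem3p4 (G : finGroupType) :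
  ~~ abelian [set: G] ->
  tensor_center G = [set 1%g] ->
  (tensor_degree G <= (pdiv #|G|)%:R^-1)%R.
Proof.
move=> nabG Z1; have [] := nonabelian_card_ge nabG.
rewrite /= cardsT; set n := #|G|; set p := pdiv n => p_pr le_n.
have p_gt0 := prime_gt0 p_pr.
have indexC x : x != 1 -> 1 < #|[set: G] : tensor_cent x|.
  by move=> x1; rewrite indexg_gt1 subTset tensor_cent_eqT Z1 inE.
have LC x : (#|tensor_cent x| * #|[set: G] : tensor_cent x| = n)%N.
  by rewrite Lagrange ?subsetT // cardsT.
have le_pC x : x != 1 -> p <= #|[set: G] : tensor_cent x|.
  by move=> x1; apply: pdiv_min_dvd; rewrite ?indexC // -(LC x) dvdn_mull.
have [k Gk k1] : exists2 k, k \in [set: G]^`(1) & k != 1.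
  by apply/trivgPn; apply: contra nabG => /eqP/derG1P.
pose H := tensor_cent_group k.
have outH x : x \notin H -> p < #|[set: G] : tensor_cent x|.
  move=> notHx; have [x1 | x1] := eqVneq x 1.
    by rewrite x1 group1 in notHx.
  rewrite ltn_neqAle le_pC // andbT; apply: contra notHx => /eqP iCx.
  have nC : tensor_cent x <| [set: G].
    by apply: pdiv_index_normal; rewrite ?subsetT // -iCx cardsT.
  rewrite tensor_centC; apply: (subsetP _ _ Gk).
  apply: der1_min; first exact: normal_norm.
  apply: cyclic_abelian; apply: prime_cyclic.
  by rewrite card_quotient ?normal_norm // -iCx.
have le_H : p * #|H| <= n.
  by rewrite -(LC k) mulnC leq_mul // le_pC.
(* The three cases in one bound, with the denominators [p] and [p.+1] cleared. The term [(p ^ 2).-1]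
   raises [p + 1] to [p * p.+1] at [x = 1], where equality holds. *)
have bound x : p * p.+1 * #|tensor_cent x| <=
    n * (p + (x \in H) + (x \in [set 1]) * (p ^ 2).-1).
  rewrite in_set1; have [-> | x1] := eqVneq x 1.
    by rewrite tensor_cent1 cardsT group1 mulnC mul1n -addnA add1n
      prednK ?expn_gt0 ?p_gt0 // -mulnS.
  rewrite mulnC -(LC x) -mulnA leq_mul2l mul0n addn0; apply/orP; right.
  have [_ | /outH ltpC] := boolP (x \in H).
    by rewrite addn1 leq_mul2r le_pC ?orbT.
  by rewrite addn0 mulnC leq_mul2r ltpC orbT.
rewrite /tensor_degree ler_pdivrMr; last first.
  by rewrite ltr0n expn_gt0 (leq_trans _ le_n) ?muln_gt0 ?p_gt0.
rewrite ler_pdivlMl ?ltr0n // -natrM ler_nat card_tensor1.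
rewrite -(leq_pmul2l (ltn0Sn p)) mulnA [(p.+1 * p)%N]mulnC big_distrr /=.
apply: leq_trans (leq_sum _ (fun x _ => bound x)) _.
have sum_mem (A : {set G}) : (\sum_x (x \in A) = #|A|)%N.
  rewrite -sum1_card [RHS]big_mkcond.
  by apply: eq_bigr => x _; case: (x \in A).
rewrite -big_distrr /= !big_split /= sum_nat_const -big_distrl /=.
rewrite !sum_mem cards1 mul1n -/n mulnCA leq_mul2l; apply/orP; right.
rewrite mulSn [(n * p)%N]mulnC -addnA [X in _ <= X]addnC leq_add2l.
(* What remains is [#|H| + (p ^ 2).-1 <= n]. After scaling by [p], it is the sum of [p * #|H| <= n]
   and [p.-1] times [p * p.+1 <= n]. *)
have : p * (#|H| + (p ^ 2).-1) <= p * n.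
  have -> : (p ^ 2).-1 = (p.+1 * p.-1)%N.
    by rewrite -subn1 -(exp1n 2) subn_sqr subn1 addn1 mulnC.
  rewrite mulnDr mulnA -[X in _ <= X * n](prednK p_gt0) mulSn leq_add //.
  by rewrite mulnC leq_mul2l le_n orbT.
by rewrite leq_pmul2l.
Qed.
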